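(* Let $\mu_0>0$ and $I_0>0$. For any pair $(L,p_z)\in(0,\infty)\times\mathbb{R}$, the planar system $$\dot r=\frac{p_r}{H(r,p_r)},\qquad \dot p_r=\frac{L^2r^{-3}-\frac{\mu_0}{2\pi}I_0r^{-1}\left(p_z+\frac{\mu_0}{2\pi}I_0\ln r\right)}{H(r,p_r)},$$ $$H(r,p_r)=\sqrt{1+\left(p_z+\tfrac{\mu_0}{2\pi}I_0\ln r\right)^2+p_r^2+L^2r^{-2}},$$ on $\{(r,p_r): r>0,\ p_r\in\mathbb{R}\}$ has a unique equilibrium $(\bar r,0)$, where $\bar r$ satisfies $$p_z+\frac{\mu_0}{2\pi}I_0\ln\bar r=\frac{2\pi}{\mu_0}\frac{L^2}{I_0}\bar r^{-2},$$ and this equilibrium is a global center.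
   Context: An equilibrium of a planar system on a domain is called a global center if every other orbit in the domain is a (nonconstant) periodic orbit surrounding the equilibrium. *)

(* Defs.v *)
From HB Require Import structures.
From mathcomp Require Import all_boot all_order all_algebra.
From mathcomp Require Import all_classical all_reals all_analysis.
Set Implicit Arguments.
Unset Strict Implicit.
Unset Printing Implicit Defensive.
Import Order.TTheory GRing.Theory Num.Theory.
Import numFieldNormedType.Exports.
Local Open Scope classical_set_scope.
Local Open Scope ring_scope.

Section PlanarSystems.
Context {R : realType}.
Implicit Types (f : R * R -> R * R) (D O : set (R * R)) (J : set R)
  (g : R -> R * R) (z e : R * R).

Definition solution f D J g : Prop := forall t, J t ->
  [/\ D (g t),
      is_derive t 1 (fun s => (g s).1) (f (g t)).1
    & is_derive t 1 (fun s => (g s).2) (f (g t)).2].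

(* The orbit through [z] collects the values of all solutions issued from [z]
   on open intervals around time 0.  When solutions are unique this is the
   image of the maximal solution. *)
Definition orbit_through f D z : set (R * R) :=
  [set w | exists J g, [/\ open J, is_interval J, J 0, solution f D J g
    & g 0 = z /\ exists2 t, J t & g t = w]].

Definition is_orbit f D O : Prop := exists2 z, D z & O = orbit_through f D z.

Definition equilibrium f D z : Prop := D z /\ f z = (0, 0).

Definition periodic_orbit f D O : Prop := exists g (T : R),
  [/\ 0 < T, solution f D setT g, forall t, g (t + T) = g t,
      exists s t, g s <> g t
    & O = range g].

(* [e] lies in a bounded component of the complement of [O] in the plane; for
   a Jordan curve [O], this is the interior.  The first clause is needed since
   the component is empty, hence bounded, when [e] is on [O]. *)
Definition surrounds O e : Prop :=
  ~ O e /\ bounded_set (connected_component (~` O) e).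

Definition global_center f D e : Prop := equilibrium f D e /\
  forall O, is_orbit f D O -> O <> [set e] ->
    periodic_orbit f D O /\ surrounds O e.

End PlanarSystems.

Section WireSystem.
Context {R : realType}.

Definition half_plane : set (R * R) := [set z : R * R | 0 < z.1].

Definition hamiltonian (mu0 I0 L pz : R) (z : R * R) : R :=
  Num.sqrt (1 + (pz + mu0 / (2 * pi) * I0 * ln z.1) ^+ 2 + z.2 ^+ 2
            + L ^+ 2 * z.1 ^- 2).

Definition wire_field (mu0 I0 L pz : R) (z : R * R) : R * R :=
  (z.2 / hamiltonian mu0 I0 L pz z,
   (L ^+ 2 * z.1 ^- 3
    - mu0 / (2 * pi) * I0 * z.1^-1 * (pz + mu0 / (2 * pi) * I0 * ln z.1))
   / hamiltonian mu0 I0 L pz z).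

End WireSystem.

(* Main.v *)
Require Import Defs.
From HB Require Import structures.
From mathcomp Require Import all_boot all_order all_algebra.
From mathcomp Require Import all_classical all_reals all_analysis.
From mathcomp Require Import ring lra.
Import Order.TTheory GRing.Theory Num.Theory.
Import numFieldNormedType.Exports.
Local Open Scope classical_set_scope.
Local Open Scope ring_scope.

(** The square of [hamiltonian] is a first integral.  In the variable
    [u = ln (r / rbar)] it reads [const + well u + p_r ^ 2], where [well] is a
    strictly convex potential with its minimum at [u = 0].  A coordinate [phi]
    with [phi u ^ 2 = well u] turns each level curve into a circle of radius
    [rho], on which the field becomes a scalar equation [a' = w a] for the
    angle, with [w] positive, continuous and 2 pi-periodic.  Such an equation is
    solved by inverting the antiderivative of [1 / w]; this gives a periodic
    solution that runs through the whole level curve.  Every solution stays on its level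
    curve, so orbits are exactly level curves, and neither an existence nor a
    uniqueness theorem for differential equations is needed. *)

Set Implicit Arguments.
Unset Strict Implicit.
Unset Printing Implicit Defensive.

(** * Real calculus: mean value, inverse functions, antiderivatives *)

Section RealLine.
Context {R : realType}.
Implicit Types (f F G : R -> R) (x y z : R).

Lemma is_derive_continuous f l x : is_derive x 1 f l -> {for x, continuous f}.
Proof. by move=> [df _]; apply/differentiable_continuous/derivable1_diffP. Qed.

Lemma is_derive_within f (df : R -> R) (A : set R) :
  (forall x, A x -> is_derive x 1 f (df x)) -> {within A, continuous f}.
Proof.
move=> fd; apply: continuous_in_subspaceT => x /set_mem Ax.
exact: is_derive_continuous (fd _ Ax).
Qed.

Lemma is_derive_mvt f (df : R -> R) x y : x < y ->
  (forall z, x <= z <= y -> is_derive z 1 f (df z)) ->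
  exists2 c, x < c < y & f y - f x = df c * (y - x).
Proof.
move=> xy fd.
have [||c] := @MVT R f df x y xy.
- by move=> z; rewrite in_itv/= => /andP[/ltW xz /ltW zy]; apply: fd; rewrite xz.
- by apply: (@is_derive_within _ df) => z /=; rewrite in_itv/=; exact: fd.
- by rewrite in_itv/= => cxy e; exists c.
Qed.

(** The domain is a general interval because the solutions collected by [orbit_through] need not be
    defined for all time. *)
Lemma is_derive0_interval_cst f (J : set R) x y : is_interval J -> J x -> J y ->
  (forall z, J z -> is_derive z 1 f 0) -> f x = f y.
Proof.
move=> iJ; wlog xy : x y / x < y => [hw Jx Jy fd|Jx Jy fd].
  have [|yx|->//] := ltgtP x y; first by move=> /hw; apply.
  by apply/esym; apply: hw.
have [|c _ /eqP] := @is_derive_mvt f (fun=> 0) x y xy.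
  by move=> z zxy; apply/fd/(iJ x y).
by rewrite mul0r subr_eq0 => /eqP.
Qed.

Lemma is_derive_gt0_mono F f : (forall x, is_derive x 1 F (f x)) ->
  (forall x, 0 < f x) -> {mono F : x y / x <= y}.
Proof.
move=> dF f0; apply: le_mono => x y xy.
have [c _ e] := is_derive_mvt xy (fun z _ => dF z).
by rewrite -subr_gt0 e mulr_gt0// subr_gt0.
Qed.

Lemma unbounded_continuous_surj F : continuous F ->
  (forall y, exists a, F a <= y) -> (forall y, exists b, y <= F b) ->
  forall y, exists x, F x = y.
Proof.
move=> cF lo hi y; have [[a Fa] [b Fb]] := (lo y, hi y).
have cw (A : set R) : {within A, continuous F} by apply: continuous_subspaceT.
have [ab|/ltW ba] := leP a b.
- by have [|c _ <-] := IVT ab (cw _) (v := y);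
    [rewrite ge_min le_max Fa Fb orbT|exists c].
- by have [|c _ <-] := IVT ba (cw _) (v := y);
    [rewrite ge_min le_max Fa Fb !orbT|exists c].
Qed.

Lemma increasing_diffeo F f : (forall x, is_derive x 1 F (f x)) ->
  (forall x, 0 < f x) -> (forall y, exists x, F x = y) ->
  exists G, [/\ cancel F G, cancel G F &
    forall y, is_derive y 1 G (f (G y))^-1].
Proof.
move=> dF f0 /choice[G GK].
have FI : injective F.
  exact/inc_inj/(is_derive_gt0_mono dF f0).
have FK : cancel F G by move=> x; apply: FI; rewrite GK.
exists G; split => // y.
rewrite -{1}(GK y); apply: is_derive_inverse => //; last exact/lt0r_neq0.
- by near=> x; exact: FK.
- by near=> x; exact: is_derive_continuous (dF x).
Unshelve. all: by end_near. Qed.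

Notation mu := (@lebesgue_measure R).

Lemma continuous_antiderivative f : continuous f ->
  exists F, forall x, is_derive x 1 F (f x).
Proof.
move=> cf.
have fi a b : mu.-integrable `[a, b] (EFin \o f).
  apply: continuous_compact_integrable; first exact: segment_compact.
  exact: continuous_subspaceT.
pose I a x := \int[mu]_(t in `[a, x]) f t.
have IB a b x : a <= b -> b <= x -> I a x = I a b + I b x.
  move=> ab bx; apply/eqP; rewrite addrC -subr_eq; apply/eqP.
  rewrite /I Rintegral_itvB//.
  rewrite Rintegral_itv_obnd_cbnd//.
  by apply: integrableS (fi b x) => //; exact: subset_itv_oc_cc.
(* [I a x] is a usable primitive only for [a] below [x], so the base point moves with [x] and stays
   below both [x] and 0; subtracting the integral up to 0 makes the value independent of the base
   point. *)
pose F x := I (- `|x|) x - I (- `|x|) 0.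
have FE a x : a <= x -> a <= 0 -> F x = I a x - I a 0.
  have H b c y : b <= c -> c <= 0 -> c <= y -> I b y - I b 0 = I c y - I c 0.
    by move=> bc c0 cy; rewrite (IB b c y)// (IB b c 0)//; ring.
  have nx : - `|x| <= x by rewrite lerNl -normrN ler_norm.
  have n0 : - `|x| <= 0 by rewrite oppr_le0.
  move=> ax a0; have [l|l] := ltP a (- `|x|).
    by rewrite /F -(H a) ?(ltW l).
  by rewrite /F (H _ a).
exists F => x.
(* Subtracting 1 puts [a] strictly below [x], so that one base point serves for all [y] near [x]. *)
pose a := - `|x| - 1.
have ax : a < x.
  by rewrite /a ltrBlDr (le_lt_trans (y := x)) ?ltrDl// lerNl -normrN ler_norm.
have [] := @continuous_FTC1_closed R f a x (x + 1) _ (fi _ _) ax (cf x).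
  by rewrite ltrDl.
rewrite derive1E => dI eI.
have {eI}dI : is_derive x 1 (I a) (f x) by apply: DeriveDef.
apply: (@near_eq_is_derive _ _ _ (I a - cst (I a 0))).
  near=> y; rewrite (FE a)//.
    by apply: ltW; near: y; exact: lt_nbhsr.
  by rewrite /a subr_le0 (le_trans (y := 0))// oppr_le0.
by apply: is_derive_eq; rewrite subr0.
Unshelve. all: by end_near. Qed.

(** The extended quotient is exactly the Caratheodory slope function of [f] at 0, which is
    continuous there. *)
Lemma cvg_divided_difference f l : is_derive (0 : R) 1 f l ->
  (if u == 0 then l else (f u - f 0) / u) @[u --> (0 : R)] --> l.
Proof.
move=> /is_derive1_caratheodory[h [fE ch h0]].
rewrite (_ : (fun _ => _) = h); first by rewrite -h0; exact: ch.
apply/funext => u.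
by have [->|u0] := eqVneq u 0; rewrite ?h0// fE subr0 mulfK.
Qed.

End RealLine.

(** * Differentiation rules for functions given by pointwise formulas *)

Section PointwiseDerivatives.
Context {R : realType}.
Implicit Types (f g : R -> R) (c x a b : R).

Lemma is_derive_add f g x a b : is_derive x 1 f a -> is_derive x 1 g b ->
  is_derive x 1 (fun y => f y + g y) (a + b).
Proof. exact: is_deriveD. Qed.

Lemma is_derive_sub f g x a b : is_derive x 1 f a -> is_derive x 1 g b ->
  is_derive x 1 (fun y => f y - g y) (a - b).
Proof. exact: is_deriveB. Qed.

Lemma is_derive_mul f g x a b : is_derive x 1 f a -> is_derive x 1 g b ->
  is_derive x 1 (fun y => f y * g y) (f x * b + g x * a).
Proof. exact: is_deriveM. Qed.

Lemma is_derive_scale f c x a : is_derive x 1 f a ->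
  is_derive x 1 (fun y => c * f y) (c * a).
Proof. exact: is_deriveZ. Qed.

Lemma is_derive_sqr f x a : is_derive x 1 f a ->
  is_derive x 1 (fun y => f y ^+ 2) (2 * f x * a).
Proof.
by move=> fa; apply: is_derive_eq (is_derive_mul fa fa) _; ring.
Qed.

Lemma is_derive_expscale c x :
  is_derive x 1 (fun y => expR (c * y)) (c * expR (c * x)).
Proof.
have d := is_derive1_comp (is_derive_expR _) (is_derive_scale c (is_derive_id x 1)).
by apply: is_derive_eq d _; rewrite mulr1 mulrC.
Qed.

End PointwiseDerivatives.

(** * Periodic scalar equations and square-root charts *)

Section Charts.
Context {R : realType}.
Implicit Types (f F G tau : R -> R) (x y z u t : R).

(** An antiderivative [F] of [tau] gives time as a function of the angle, so its inverse [theta] is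
    the flow; the time [T] of one turn is the increment of [F] over a period. *)
Lemma scalar_periodic_flow tau (P : R) : continuous tau ->
  (forall x, 0 < tau x) -> 0 < P -> (forall x, tau (x + P) = tau x) ->
  exists theta (T : R), [/\ 0 < T,
    forall t, is_derive t 1 theta (tau (theta t))^-1,
    forall t, theta (t + T) = theta t + P &
    forall x, exists t, theta t = x].
Proof.
move=> ctau tau0 P0 tauP.
have [F dF] := continuous_antiderivative ctau.
have Fmono := is_derive_gt0_mono dF tau0.
have cF : continuous F by move=> x; exact: is_derive_continuous (dF x).
have [T T0 FP] : exists2 T, 0 < T & forall x, F (x + P) = F x + T.
  exists (F P - F 0) => [|x]; first by rewrite subr_gt0 (leW_mono Fmono).
  have d y : setT y -> is_derive y 1 ((F \o shift P) - F) 0.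
    move=> _; rewrite -(subrr (tau y)).
    apply: is_deriveB; rewrite -tauP -[tau (y + P)]mulr1.
    exact: (is_derive1_comp (dF _) (is_derive_shift _ _ P)).
  have itvT : is_interval [set: R] by [].
  have := is_derive0_interval_cst itvT (I : setT x) (I : setT 0) d.
  by rewrite !fctE /= add0r => e; lra.
(* Along multiples of [P], [F] changes by multiples of [T > 0]; it is thus unbounded both ways,
   hence onto, and [theta] is defined for all time. *)
have FnP n x : F (x + P *+ n) = F x + T *+ n.
  elim: n => [|n IH]; first by rewrite !mulr0n !addr0.
  by rewrite !mulrSr !addrA FP IH.
have [|theta [FK thetaK dtheta]] := increasing_diffeo dF tau0.
  apply: unbounded_continuous_surj => // y.
    have [n /ltW nT] : exists n, F 0 - y < T *+ n.
      exists (Num.bound `|(F 0 - y) / T|).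
      rewrite -mulr_natr -ltr_pdivrMl// mulrC.
      by rewrite (le_lt_trans (ler_norm _))// archi_boundP.
    exists (- (P *+ n)).
    by have := FnP n (- (P *+ n)); rewrite addNr => e; lra.
  have [n /ltW nT] : exists n, y - F 0 < T *+ n.
    exists (Num.bound `|(y - F 0) / T|).
    rewrite -mulr_natr -ltr_pdivrMl// mulrC.
    by rewrite (le_lt_trans (ler_norm _))// archi_boundP.
  by exists (0 + P *+ n); rewrite FnP; lra.
exists theta, T; split => //.
- by move=> t; rewrite -{1}(thetaK t) -FP FK.
- by move=> x; exists (F x).
Qed.

(* Away from 0 the chart is [sgn u * sqrt (F u)]; writing it as
   [u * sqrt (F u / u^2)] and extending the quotient by its limit [n 0] makes
   it regular at the nondegenerate minimum. *)
Lemma square_root_chart F (n : R -> R) (c : R) :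
  (forall u, is_derive u 1 F (2 * u * n u)) -> F 0 = 0 -> continuous n ->
  0 < c -> (forall u, c ^+ 2 <= n u) ->
  exists phi omega : R -> R, [/\ forall u, phi u ^+ 2 = F u,
    forall u, is_derive u 1 phi (omega u),
    forall u, 0 < omega u /\ phi u * omega u = u * n u,
    continuous omega &
    forall y, exists u, phi u = y].
Proof.
move=> dF F0 cn c0 cle.
have cF : continuous F by move=> x; exact: is_derive_continuous (dF x).
have dsq (u : R) : is_derive u 1 (fun v : R => v ^+ 2) (2 * u).
  by rewrite -[2 * u]mulr1; exact: is_derive_sqr (is_derive_id _ _).
(* The difference of the two sides has a derivative that is nonnegative right of 0 and nonpositive
   left of it, so its minimum is at 0. This keeps [q] above [c ^ 2]. *)
have Fge u : c ^+ 2 * u ^+ 2 <= F u.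
  pose D (u : R) := F u - c ^+ 2 * u ^+ 2.
  have dD (v : R) : is_derive v 1 D (2 * v * (n v - c ^+ 2)).
    rewrite (_ : _ * _ = 2 * v * n v - c ^+ 2 * (2 * v)); last by ring.
    by apply: is_derive_sub => //; exact: is_derive_scale.
  have D0 : D 0 = 0 by rewrite /D F0 expr0n mulr0 subr0.
  rewrite -subr_ge0 -/(D u).
  have [u0|u0|<-] := ltgtP 0 u; last by rewrite D0.
    have [v /andP[v0 _]] := is_derive_mvt u0 (fun z _ => dD z).
    by rewrite D0 !subr0 => ->; rewrite !mulr_ge0 ?subr_ge0// ltW.
  have [v /andP[_ v0]] := is_derive_mvt u0 (fun z _ => dD z).
  rewrite D0 !sub0r mulrN => /oppr_inj ->.
  by rewrite mulrAC mulr_ge0 ?subr_ge0// -mulrA mulr_ge0// ltW// nmulr_rgt0.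
pose q u := if u == 0 then n 0 else F u / u ^+ 2.
have qE u : u != 0 -> q u = F u / u ^+ 2 by rewrite /q => /negPf ->.
have Fq u : F u = u ^+ 2 * q u.
  have [->|u0] := eqVneq u 0; first by rewrite F0 expr0n mul0r.
  by rewrite qE// mulrC divfK// expf_neq0.
have qge u : c ^+ 2 <= q u.
  have [->|u0] := eqVneq u 0; first by rewrite /q eqxx.
  by rewrite qE// ler_pdivlMr// exprn_even_gt0.
have q0 u : 0 < q u by rewrite (lt_le_trans _ (qge u))// exprn_gt0.
have dq (u : R) : u != 0 -> is_derive u 1 q (2 * (n u - q u) / u).
  move=> u0; apply: (@near_eq_is_derive _ _ _ (fun v => F v * (v ^+ 2)^-1)).
    near=> v; rewrite qE//; near: v.
    exact: (open_nbhs_nbhs (conj (@open_neq _ 0) _)).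
  have du : is_derive u 1 (fun v : R => (v ^+ 2)^-1) (- (u ^+ 2) ^- 2 * (2 * u)).
    by apply: is_deriveV; rewrite ?expf_neq0.
  apply: is_derive_eq (is_derive_mul (dF u) du) _.
  by rewrite qE//; field.
have cq : continuous q.
  move=> y; have [->|y0] := eqVneq y 0;
    last exact: is_derive_continuous (dq y y0).
  apply/continuous_withinNx.
  rewrite {2}/q eqxx.
  have H : F x / x ^+ 2 @[x --> (0 : R)^'] --> n 0.
    (* Both derivatives vanish at 0, where their quotient would take the default value 0; [e] puts
       [n 0 / 1] there, so the ratio is [n] everywhere and its limit is the continuity of [n]. *)
    pose e (a b u : R) := if u == 0 then a else b.
    have e0 a b u : u != 0 -> e a b u = b by rewrite /e => /negPf ->.
    apply: (@lhopital R F (fun u => e (n 0) (2 * u * n u) u)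
      (fun u => u ^+ 2) (fun u => e 1 (2 * u) u) (-1) 1 0 (n 0)).
    - by rewrite in_itv/=; lra.
    - by move=> x /set_mem [_ /eqP x0]; rewrite e0//; exact: dF.
    - by move=> x /set_mem [_ /eqP x0]; rewrite e0//; exact: dsq.
    - by have := cF 0; rewrite /continuous_at F0.
    - have h : v ^+ 2 @[v --> (0 : R)] --> (0 : R) ^+ 2.
        exact: is_derive_continuous (dsq 0).
      by rewrite expr0n in h.
    - by move=> x /set_mem [_ /eqP x0]; rewrite e0// mulf_neq0.
    - rewrite (_ : (fun _ => _) = n); first exact: cn.
      apply/funext => x; have [->|x0] := eqVneq x 0; first by rewrite /e eqxx divr1.
      by rewrite !e0// mulrAC mulfV ?mul1r// mulf_neq0.
  apply: cvg_trans H; apply: near_eq_cvg; near=> x; rewrite qE//.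
  by near: x; exact: nbhs_dnbhs_neq.
(* Differentiating [phi ^ 2 = F] gives [phi * phi' = u * n]; with [phi = u * sqrt q] this forces
   [phi' = n / sqrt q]. *)
pose om u := n u / Num.sqrt (q u).
have sq0 u : 0 < Num.sqrt (q u) by rewrite sqrtr_gt0.
have csq : continuous (Num.sqrt \o q).
  by move=> u; apply: continuous_comp; [exact: cq|exact: sqrt_continuous].
have dphi (u : R) : is_derive u 1 (fun u => u * Num.sqrt (q u)) (om u).
  have [->|u0] := eqVneq u 0.
    (* At 0 the factor [sqrt q] is itself the Caratheodory slope of [u * sqrt q], and its value
       there is [om 0] because [q 0 = n 0]. *)
    apply/is_derive1_caratheodory; exists (Num.sqrt \o q); split.
    - by move=> z; rewrite /= mul0r !subr0 mulrC.
    - exact: csq.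
    - rewrite /om /= /q eqxx -[X in _ = X / _](@sqr_sqrtr _ (n 0)).
        by rewrite expr2 mulfK// -[n 0](_ : q 0 = _) ?gt_eqF// /q eqxx.
      by rewrite (le_trans _ (cle 0))// exprn_ge0// ltW.
  have ds := is_derive1_comp (is_derive1_sqrt (q0 u)) (dq u u0).
  apply: is_derive_eq (is_derive_mul (is_derive_id _ _) ds) _.
  rewrite /om /=.
  have := sq0 u.
  have : Num.sqrt (q u) ^+ 2 = q u by rewrite sqr_sqrtr// ltW.
  set s := Num.sqrt _ => <- s0; field.
  by rewrite u0 gt_eqF.
have phisq u : (u * Num.sqrt (q u)) ^+ 2 = F u.
  by rewrite exprMn sqr_sqrtr ?Fq// ltW.
have n0 u : 0 < n u by rewrite (lt_le_trans _ (cle u))// exprn_gt0.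
exists (fun u => u * Num.sqrt (q u)), om; split => //.
- move=> u; split; first by rewrite divr_gt0.
  by rewrite /om; field; rewrite gt_eqF.
- move=> u; apply: cvgM; first exact: cn.
  by apply: cvgV; [rewrite gt_eqF//=|exact: csq].
(* As [sqrt q] is at least [c], the chart has modulus at least [|y|] at [|y| / c] and at its
   opposite, which brackets [y]. *)
- have cs u : c <= Num.sqrt (q u).
    by rewrite -[X in X <= _](ger0_norm (ltW c0)) -sqrtr_sqr ler_sqrt ?qge ?ltW.
  have yc (y u : R) : `|y| <= `|y| / c * Num.sqrt (q u).
    by rewrite -{1}[`|y|](divfK (lt0r_neq0 c0)) ler_wpM2l// divr_ge0// ltW.
  apply: unbounded_continuous_surj.
  + by move=> u; exact: is_derive_continuous (dphi u).
  + move=> y; exists (- (`|y| / c)).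
    by rewrite mulNr lerNl (le_trans _ (yc y _))// -normrN ler_norm.
  + move=> y; exists (`|y| / c).
    by rewrite (le_trans _ (yc y _))// ler_norm.
Unshelve. all: by end_near. Qed.
End Charts.

(** * Polar coordinates and the potential well *)

Section WireDynamics.
Context {R : realType}.
Implicit Types (r p u t rho : R) (z : R * R).

Lemma polar_coordinates (x y rho : R) : 0 < rho -> x ^+ 2 + y ^+ 2 = rho ^+ 2 ->
  exists a, rho * cos a = x /\ rho * sin a = y.
Proof.
move=> rho0 e.
have xy : (x / rho) ^+ 2 + (y / rho) ^+ 2 = 1.
  by rewrite !expr_div_n -mulrDl e divff// expf_neq0// gt_eqF.
have x1 : -1 <= x / rho <= 1.
  by rewrite -ler_norml -(@ler_pXn2r _ 2)// ?nnegrE// expr1n real_normK ?num_real//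
    -xy lerDl sqr_ge0.
have cE : rho * cos (acos (x / rho)) = x.
  by rewrite acosK ?in_itv//= mulrC divfK// gt_eqF.
have sE : rho * sin (acos (x / rho)) = `|y|.
  rewrite sin_acos// -xy addrC addKr sqrtr_sqr normrM normfV (gtr0_norm rho0).
  by rewrite mulrC divfK// gt_eqF.
(* [acos] only yields angles with nonnegative sine, so the sign of [y] is restored by negating the
   angle. *)
have [y0|/ltW y0] := leP 0 y.
  by exists (acos (x / rho)); rewrite cE sE ger0_norm.
by exists (- acos (x / rho)); rewrite cosN sinN mulrN cE sE ler0_norm// opprK.
Qed.

(** With [M = L ^ 2 / rbar ^ 2] this is the excess of [energy] over its equilibrium value at
    [p_r = 0]. The exponential is the centrifugal term; the linear term is the cross term of the
    expanded square, rewritten by the equilibrium equation. *)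
Definition well (k M u : R) : R := k ^+ 2 * u ^+ 2 + M * (expR (- 2 * u) - 1 + 2 * u).

(** The derivative of [well] divided by [2 * u]; the value 2 at 0 is the limit of the quotient and
    makes the function continuous. *)
Definition well_slope (k M u : R) : R :=
  k ^+ 2 + M * (if u == 0 then 2 else (1 - expR (- 2 * u)) / u).

Lemma well_ge (k M u : R) : 0 <= M -> k ^+ 2 * u ^+ 2 <= well k M u.
Proof.
move=> M0; rewrite /well lerDl mulr_ge0//.
by have := expR_ge1Dx (- 2 * u); lra.
Qed.

Lemma well_slope_ge (k M u : R) : 0 <= M -> k ^+ 2 <= well_slope k M u.
Proof.
move=> M0; rewrite /well_slope lerDl mulr_ge0//.
have [u0|u0|//] := ltgtP u 0.
  by rewrite ler_ndivlMr// mul0r subr_le0 leNgt expR_lt1; lra.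
by rewrite divr_ge0 ?(ltW u0)// subr_ge0 expR_le1; lra.
Qed.

Lemma is_derive_well (k M u : R) :
  is_derive u 1 (well k M) (2 * u * well_slope k M u).
Proof.
have di := is_derive_id u (1 : R).
have d := is_derive_add (is_derive_scale (k ^+ 2) (is_derive_sqr di))
  (is_derive_scale M (is_derive_add
    (is_derive_sub (is_derive_expscale (- 2) u) (is_derive_cst (1 : R) u 1))
    (is_derive_scale 2 di))).
apply: is_derive_eq d _; rewrite /well_slope.
case: eqP => [->|/eqP u0]; first by rewrite !mulr0 expR0; ring.
by field.
Qed.

Lemma continuous_well_slope (k M : R) : continuous (well_slope k M).
Proof.
have d (x : R) : is_derive x 1 (fun u => 1 - expR (- 2 * u)) (2 * expR (- 2 * x)).
  have d1 := is_derive_sub (is_derive_cst (1 : R) x 1)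
    (is_derive_expscale (- 2) x).
  by apply: is_derive_eq d1 _; lra.
pose g (u : R) := if u == 0 then 2 else
  (1 - expR (- 2 * u) - (1 - expR (- 2 * 0))) / u.
have -> : well_slope k M = fun u => k ^+ 2 + M * g u.
  by apply/funext => u; rewrite /well_slope /g mulr0 expR0 subrr subr0.
suff cg (u : R) : g v @[v --> u] --> g u.
  by move=> u; apply: cvgD; [exact: cvg_cst|apply: cvgMr; exact: cg].
have [->|u0] := eqVneq u 0.
  have d0 : is_derive (0 : R) 1 (fun u => 1 - expR (- 2 * u)) 2.
    by apply: is_derive_eq (d 0) _; rewrite mulr0 expR0 mulr1.
  by have := cvg_divided_difference d0; rewrite {2}/g eqxx.
rewrite {2}/g (negPf u0).
have dV := is_deriveV u0 (is_derive_id u (1 : R)).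
have dB := is_derive_sub (d u) (is_derive_cst (1 - expR (- 2 * 0)) u 1).
apply: cvg_trans (is_derive_continuous (is_derive_mul dB dV)).
apply: near_eq_cvg; near=> v; rewrite /g ifF//; apply/negbTE.
by near: v; exact: open_neq.
Unshelve. all: by end_near. Qed.

(** * Conservation of energy along the wire system *)

Context (mu0 I0 L pz : R).
Context (hmu0 : 0 < mu0).
Context (hI0 : 0 < I0).
Context (hL : 0 < L).
Local Notation k := (mu0 / (2 * pi) * I0).
Local Notation field := (wire_field mu0 I0 L pz).

Lemma coupling_gt0 : 0 < k.
Proof. by rewrite !mulr_gt0// invr_gt0 mulr_gt0// pi_gt0. Qed.
Let k0 := coupling_gt0.

(** The square of [hamiltonian] minus 1, a first integral free of square roots. *)
Definition energy (z : R * R) : R :=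
  (pz + k * ln z.1) ^+ 2 + z.2 ^+ 2 + L ^+ 2 * (z.1 ^+ 2)^-1.

Lemma hamiltonianE z : hamiltonian mu0 I0 L pz z = Num.sqrt (1 + energy z).
Proof. by rewrite /hamiltonian /energy !addrA. Qed.

Lemma energy_ge0 z : 0 <= energy z.
Proof.
by rewrite !addr_ge0 ?sqr_ge0// mulr_ge0 ?sqr_ge0// invr_ge0 sqr_ge0.
Qed.

Lemma hamiltonian_gt0 z : 0 < hamiltonian mu0 I0 L pz z.
Proof. by rewrite hamiltonianE sqrtr_gt0 ltr_wpDr ?energy_ge0. Qed.

(** The [r]-derivative of [energy] is minus twice the numerator of the force and its
    [p_r]-derivative is [2 * p_r], so along the field the two contributions cancel. *)
Lemma energy_conserved (J : set R) g (s t : R) : is_interval J ->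
  solution field half_plane J g -> J s -> J t ->
  energy (g s) = energy (g t).
Proof.
move=> iJ sol Js Jt.
apply: (@is_derive0_interval_cst _ (energy \o g) J) => // x Jx.
have [/= r0 d1 d2] := sol _ Jx.
have r_neq0 : (g x).1 != 0 by rewrite gt_eqF.
have dln := is_derive1_comp (is_derive1_ln r0) d1.
have dpot := is_derive_sqr (is_derive_add (is_derive_cst pz x 1)
  (is_derive_scale k dln)).
have r2 : (g x).1 ^+ 2 != 0 by rewrite expf_neq0.
have dinv := @is_deriveV _ (fun s => (g s).1 ^+ 2) _ _ _ r2 (is_derive_sqr d1).
have d := is_derive_add (is_derive_add dpot (is_derive_sqr d2))
  (is_derive_scale (L ^+ 2) dinv).
apply: is_derive_eq d _.
rewrite /wire_field /= /cst /GRing.scale /=.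
have := lt0r_neq0 (hamiltonian_gt0 (g x)).
set h := hamiltonian _ _ _ _ _ => h0.
move: (ln _) => l; set kk := k; clearbody kk h.
by field; rewrite h0.
Qed.

(** * Equilibrium, level curves and orbits *)

Section AtEquilibrium.
Context (rb : R).
Context (rb0 : 0 < rb).
Local Notation M := (L ^+ 2 * rb ^- 2).
Context (rbE : k * (pz + k * ln rb) = M).

Let M0 : 0 < M. Proof. by rewrite mulr_gt0 ?exprn_gt0// invr_gt0 exprn_gt0. Qed.

Lemma energy_logE (u p : R) :
  energy (rb * expR u, p) = energy (rb, 0) + well k M u + p ^+ 2.
Proof.
rewrite /energy /well /= lnM ?posrE ?expR_gt0// expRK.
rewrite (_ : expR (- 2 * u) = (expR u ^+ 2)^-1); last first.
  by rewrite mulNr expRN -expRM_natl.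
have := rbE; set kk := k; set l := ln rb; set E := expR u => e.
have E0 : E != 0 by rewrite gt_eqF// expR_gt0.
have b0 : rb != 0 by rewrite gt_eqF.
have -> : (pz + kk * (l + u)) ^+ 2 = (pz + kk * l) ^+ 2 + 2 * (kk * (pz + kk * l)) * u
  + kk ^+ 2 * u ^+ 2 by ring.
by rewrite e; field; rewrite E0 b0.
Qed.

Lemma energy_half_planeE z : 0 < z.1 ->
  energy z = energy (rb, 0) + well k M (ln (z.1 / rb)) + z.2 ^+ 2.
Proof.
case: z => r p /= r0; rewrite -energy_logE lnK ?posrE ?divr_gt0//.
by rewrite mulrCA divff ?mulr1// gt_eqF.
Qed.

(** The force is minus half the [r]-derivative of [energy], and [dr = r du]. In this form it
    vanishes only at [u = 0] and fits the chart identity [phi * phi' = u * n]. *)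
Lemma wire_force_well u :
  L ^+ 2 * (rb * expR u) ^- 3 - k * (rb * expR u)^-1 * (pz + k * ln (rb * expR u))
  = - (u * well_slope k M u) / (rb * expR u).
Proof.
rewrite lnM ?posrE ?expR_gt0// expRK.
have -> : u * well_slope k M u = k ^+ 2 * u + M * (1 - (expR u ^+ 2)^-1).
  rewrite (_ : (expR u ^+ 2)^-1 = expR (- 2 * u)); last first.
    by rewrite mulNr expRN -expRM_natl.
  rewrite /well_slope; case: eqP => [->|/eqP u0].
    by rewrite !(mulr0, mul0r) expR0 subrr mulr0 addr0.
  by move: k M (expR _) => kk m E; field.
have := rbE; set kk := k; set l := ln rb; set E := expR u => e.
have E0 : E != 0 by rewrite gt_eqF// expR_gt0.
have b0 : rb != 0 by rewrite gt_eqF.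
have -> : kk * (rb * E)^-1 * (pz + kk * (l + u)) =
  (kk * (pz + kk * l) + kk ^+ 2 * u) / (rb * E) by field; rewrite E0 b0.
by rewrite e; field; rewrite E0 b0.
Qed.

Lemma wire_equilibriumP z : equilibrium field half_plane z <-> z = (rb, 0).
Proof.
have L0 := lt0r_neq0 hL; have b0 := lt0r_neq0 rb0.
split=> [[/= r0] /eqP|->]; last first.
  split; first exact: rb0.
  have := wire_force_well 0.
  rewrite expR0 mulr1 mul0r oppr0 mul0r /wire_field /= => ->.
  by rewrite !mul0r.
case: z r0 => r p /= r0.
rewrite -[r](_ : rb * expR (ln (r / rb)) = r); last first.
  by rewrite lnK ?posrE ?divr_gt0// mulrCA divff ?mulr1.
move: (ln _) => u.
rewrite /wire_field /= wire_force_well xpair_eqE.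
have s0 : 0 < well_slope k M u.
  by rewrite (lt_le_trans _ (well_slope_ge _ _ (ltW M0)))// exprn_gt0.
rewrite 2!mulf_eq0 invr_eq0 (gt_eqF (hamiltonian_gt0 _)) !orbF.
rewrite mulf_eq0 invr_eq0 (gt_eqF (mulr_gt0 rb0 (expR_gt0 u))) orbF.
rewrite oppr_eq0 mulf_eq0 (gt_eqF s0) orbF.
by move=> /andP[/eqP -> /eqP ->]; rewrite expR0 mulr1.
Qed.

Definition level (c : R) : set (R * R) :=
  [set z | half_plane z /\ energy z = energy (rb, 0) + c].

(* In the chart [phi] with [phi u ^ 2 = well u], where [u = ln (r / rb)], the
   level curve is the circle [phi u = rho cos a, p = - rho sin a], and the
   field becomes the scalar equation [a' = phi' (u) / (r h)]. *)
Lemma level_periodic (rho : R) : 0 < rho ->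
  exists g (T : R), [/\ 0 < T, solution field half_plane setT g,
    forall t, g (t + T) = g t, exists s t, g s <> g t
    & range g = level (rho ^+ 2)].
Proof.
move=> rho0; have M_ge0 := ltW M0.
have [|||||phi [om [phi2 dphi omP com surj]]] :=
    @square_root_chart R (well k M) (well_slope k M) k.
- exact: is_derive_well.
- by rewrite /well expr0n !mulr0 expR0 addr0 subrr mulr0 addr0.
- exact: continuous_well_slope.
- exact: coupling_gt0.
- by move=> u; exact: well_slope_ge.
have om0 u : 0 < om u by case: (omP u).
have [psi [phiK psiK dpsi]] := increasing_diffeo dphi om0 surj.
pose h := Num.sqrt (1 + (energy (rb, 0) + rho ^+ 2)).
have h0 : 0 < h by rewrite sqrtr_gt0 ltr_wpDr// addr_ge0 ?energy_ge0// sqr_ge0.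
pose U a := psi (rho * cos a).
(* Time per unit angle, the reciprocal of the angular speed; [h] is the constant value of
   [hamiltonian] on the level curve. *)
pose tau a := rb * expR (U a) * h / om (U a).
have dU (a : R) : is_derive a 1 U ((om (U a))^-1 * (rho * - sin a)).
  exact: is_derive1_comp (dpsi _) (is_derive_scale _ (is_derive_cos a)).
have cU : continuous U by move=> a; exact: is_derive_continuous (dU a).
have ctau : continuous tau.
  move=> a; apply: cvgM.
    apply: cvgMl; apply: cvgMr.
    by apply: continuous_comp; [exact: cU|exact: continuous_expR].
  apply: cvgV; first by rewrite gt_eqF.
  by apply: continuous_comp; [exact: cU|exact: com].
have tau0 a : 0 < tau a by rewrite divr_gt0// !mulr_gt0// expR_gt0.
have [||theta [T [T0 dtheta thetaT theta_surj]]] :=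
    scalar_periodic_flow (P := pi *+ 2) ctau tau0.
- by rewrite pmulrn_lgt0// pi_gt0.
- by move=> a; rewrite /tau /U cosD2pi.
pose g t := (rb * expR (U (theta t)), - rho * sin (theta t)).
have levelE u p : level (rho ^+ 2) (rb * expR u, p) <->
    phi u ^+ 2 + p ^+ 2 = rho ^+ 2.
  rewrite /level /half_plane /= mulr_gt0 ?expR_gt0//.
  rewrite energy_logE// phi2; split=> [[_ ?]|?]; last split => //; lra.
have g_level t : level (rho ^+ 2) (g t).
  apply/levelE; rewrite psiK.
  have := cos2Dsin2 (theta t); nra.
have gh t : hamiltonian mu0 I0 L pz (g t) = h.
  by rewrite hamiltonianE (g_level t).2.
exists g, T; split => //.
- move=> t _; split; first exact: (g_level t).1.
  + have d := is_derive_scale rb (is_derive1_comp (is_derive_expR _)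
      (is_derive1_comp (dU (theta t)) (dtheta t))).
    apply: is_derive_eq d _; rewrite /wire_field gh /tau /=.
    have := om0 (U (theta t)); have := expR_gt0 (U (theta t)).
    move: (expR _) (om _) => E w E0 w0; field.
    by rewrite !gt_eqF.
  + have d := is_derive_scale (- rho) (is_derive1_comp (is_derive_sin _) (dtheta t)).
    apply: is_derive_eq d _; rewrite /wire_field gh /g.
    rewrite [(_, _).1]/= [(_, _).2]/= wire_force_well// -(omP _).2 psiK /tau.
    have := om0 (U (theta t)); have := expR_gt0 (U (theta t)).
    move: (expR _) (om _) => E w E0 w0; field.
    by rewrite !gt_eqF.
- by move=> t; rewrite /g thetaT /U cosD2pi sinD2pi.
(* The angles 0 and [pi / 2] are both attained and carry the distinct momenta 0 and [- rho]. *)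
- have [s s0] := theta_surj 0; have [t tp] := theta_surj (pi / 2).
  exists s, t; rewrite /g s0 tp sin0 sin_pihalf => -[_]; lra.
- apply/seteqP; split=> [_ [t _ <-]//|[r p] rp].
  have [r0 _] := rp; rewrite /half_plane /= in r0.
  have rE : r = rb * expR (ln (r / rb)).
    by rewrite lnK ?posrE ?divr_gt0// mulrCA divff ?mulr1// gt_eqF.
  move: rp; rewrite rE; set u := ln _ => /levelE e.
  have [|a [ca sa]] := @polar_coordinates (phi u) (- p) rho rho0.
    by rewrite sqrrN.
  have [t ta] := theta_surj a.
  by exists t => //; rewrite /g ta /U ca phiK mulNr sa opprK.
Qed.

(** The quadratic lower bound on [well] confines each level curve to an elliptic region in the
    coordinates [ln (r / rb)] and [p_r]. *)
Lemma level_well_le c z : level c z ->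
  k ^+ 2 * ln (z.1 / rb) ^+ 2 + z.2 ^+ 2 <= c.
Proof.
move=> [z0 e]; move: e; rewrite energy_half_planeE//.
by have := well_ge k (ln (z.1 / rb)) (ltW M0); lra.
Qed.

Lemma level0_eq z : level 0 z -> z = (rb, 0).
Proof.
move=> lz.
have z0 := lz.1; have := level_well_le lz.
have ln2 : 0 <= k ^+ 2 * ln (z.1 / rb) ^+ 2 by rewrite mulr_ge0 ?sqr_ge0.
have p2 := sqr_ge0 z.2; move=> le0.
have /eqP : z.2 ^+ 2 = 0 by lra.
have /eqP : k ^+ 2 * ln (z.1 / rb) ^+ 2 = 0 by lra.
rewrite mulf_eq0 !expf_eq0 (gt_eqF k0) /= => /eqP lnz /eqP pz0.
have : z.1 / rb = 1 by rewrite -[LHS]lnK ?posrE ?divr_gt0// lnz expR0.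
move/divr1_eq => zr.
by rewrite [z]surjective_pairing zr pz0.
Qed.

Lemma orbit_sub_level c z : level c z ->
  orbit_through field half_plane z `<=` level c.
Proof.
move=> [_ e] _ [J [g [_ iJ J0 sol [g0 [t Jt <-]]]]].
split; first by case: (sol _ Jt).
by rewrite -e -g0; exact: energy_conserved sol Jt J0.
Qed.

(** The system is autonomous, so a time translate of the one solution [g] joins any two points of
    the level curve; conservation of energy gives the other inclusion. *)
Lemma orbit_level (g : R -> R * R) c z :
  solution field half_plane setT g -> range g = level c -> level c z ->
  orbit_through field half_plane z = level c.
Proof.
move=> sol gE cz; apply/seteqP; split; first exact: orbit_sub_level.
move=> w; move: cz; rewrite -gE => -[s _ <-] [t _ <-].
exists setT, (fun x => g (x + s)); split => //.
- exact: openT.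
- move=> x _; have [D1 d1 d2] := sol (x + s) I.
  have ds := is_derive_shift x (1 : R) s.
  split => //.
  + apply: is_derive_eq (is_derive1_comp (g := shift s) d1 ds) _.
    by rewrite mulr1.
  + apply: is_derive_eq (is_derive1_comp (g := shift s) d2 ds) _.
    by rewrite mulr1.
- by split; [rewrite add0r|exists (t - s) => //; rewrite subrK].
Qed.

(** Conservation of energy keeps every solution in the zero level, which is a single point. *)
Lemma orbit_equilibrium : orbit_through field half_plane (rb, 0) = [set (rb, 0)].
Proof.
have [_ f0] := (wire_equilibriumP _).2 erefl.
have lv : level 0 (rb, 0) by split; [exact: rb0|rewrite addr0].
apply/seteqP; split=> [z /(orbit_sub_level lv) lz|_ ->].
  exact: level0_eq.
exists setT, (cst (rb, 0)); split => //.
- exact: openT.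
- move=> t _; split; first exact: rb0.
  + by rewrite f0; exact: is_derive_cst.
  + by rewrite f0; exact: is_derive_cst.
- by split => //; exists 0.
Qed.

(* The energy is cut off below [r = delta], where the sublevel set is empty,
   in order to be continuous on the whole plane. *)
Lemma level_surrounds (rho : R) : 0 < rho -> surrounds (level (rho ^+ 2)) (rb, 0).
Proof.
move=> rho0.
(* Chosen beyond the bound [|ln (r / rb)| <= rho / k] that holds on the sublevel set [V]; the extra
   1 makes the separation strict. *)
pose delta := rb * expR (- ((rho + 1) / k)).
have delta0 : 0 < delta by rewrite mulr_gt0// expR_gt0.
pose K (z : R * R) := energy (Num.max delta z.1, z.2) - energy (rb, 0).
have sqr_cvg (f : R * R -> R) (z : R * R) : f y @[y --> z] --> f z ->
    f y ^+ 2 @[y --> z] --> f z ^+ 2.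
  by move=> cf; apply: (@continuous_comp _ _ _ f (fun x => x ^+ 2));
    [exact: cf|exact: exprn_continuous].
have cK : continuous K.
  suff cKz (z : R * R) : K y @[y --> z] --> K z by [].
  pose m (y : R * R) := Num.max delta y.1.
  have c1 : m y @[y --> z] --> m z.
    have f1 : {for z, continuous (fst : R * R -> R^o)} by exact: cvg_fst.
    have h := continuous_max (@cst_continuous _ _ (delta : R^o) z) f1. exact: h.
  have m0 : 0 < m z by rewrite lt_max delta0.
  have c2 : ln (m y) @[y --> z] --> ln (m z).
    by apply: (@continuous_comp _ _ _ m (@ln R)); [exact: c1|exact: continuous_ln].
  have c3 : pz + k * ln (m y) @[y --> z] --> pz + k * ln (m z).
    exact: cvgD (cvg_cst _) (cvgMr c2).
  have c4 : L ^+ 2 * (m y ^+ 2)^-1 @[y --> z] --> L ^+ 2 * (m z ^+ 2)^-1.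
    by apply: cvgMr; apply: cvgV (sqr_cvg m _ c1); rewrite expf_neq0// gt_eqF.
  have c5 : y.2 ^+ 2 @[y --> z] --> z.2 ^+ 2 by apply: (sqr_cvg snd); exact: cvg_snd.
  exact: cvgB (cvgD (cvgD (sqr_cvg _ _ c3) c5) c4) (cvg_cst _).
have KE z : delta <= z.1 -> K z = energy z - energy (rb, 0).
  by move=> dz; rewrite /K (max_idPr dz) -surjective_pairing.
(* [U] is open, [V] is closed, and they differ only on the level curve. A connected set avoiding the
   curve meets [U] in a part both open and closed in it, so it lies in the bounded set [U] once it
   contains the equilibrium. *)
pose U := [set z : R * R | delta < z.1 /\ K z < rho ^+ 2].
pose V := [set z : R * R | delta <= z.1 /\ K z <= rho ^+ 2].
have ln_le z : V z -> `|ln (z.1 / rb)| <= rho / k /\ `|z.2| <= rho.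
  move=> [dz]; rewrite KE// => Kz.
  have z0 : 0 < z.1 by apply: lt_le_trans dz.
  have : level (energy z - energy (rb, 0)) z by split; rewrite // addrC subrK.
  move=> /level_well_le => le1.
  have le2 := le_trans le1 Kz.
  have k_ge0 := ltW k0; have rho_ge0 := ltW rho0.
  split.
    rewrite ler_pdivlMr// -(@ler_pXn2r _ 2)// ?nnegrE ?(mulr_ge0 _ k_ge0)//.
    rewrite exprMn real_normK ?num_real// [_ * k ^+ 2]mulrC.
    by apply: (le_trans _ le2); rewrite lerDl sqr_ge0.
  rewrite -(@ler_pXn2r _ 2)// ?nnegrE//.
  rewrite real_normK ?num_real//.
  by apply: (le_trans _ le2); rewrite lerDr mulr_ge0 ?sqr_ge0.
have z_gt z : V z -> delta < z.1.
  move=> Vz; have [+ _] := ln_le _ Vz; have [dz _] := Vz.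
  have z0 : 0 < z.1 by apply: lt_le_trans dz.
  rewrite ler_norml => /andP[+ _].
  rewrite /delta => h.
  rewrite -ltr_pdivlMl// [rb^-1 * _]mulrC -[ltRHS]lnK ?posrE ?divr_gt0// ltr_expR.
  by apply: lt_le_trans h; rewrite ltrN2 ltr_pM2r ?invr_gt0// ltrDl.
have cfst : continuous (fst : R * R -> R) by move=> z; exact: cvg_fst.
have oU : open U.
  move/continuousP : cfst => /(_ _ (@open_gt _ delta)) oA.
  move/continuousP : cK => /(_ _ (@open_lt _ (rho ^+ 2))) oB.
  exact: openI oA oB.
have cV : closed V.
  move/continuous_closedP : cfst => /(_ _ (@closed_ge _ delta)) cA.
  move/continuous_closedP : cK => /(_ _ (@closed_le _ (rho ^+ 2))) cB.
  exact: closedI cA cB.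
have Ue : U (rb, 0).
  have dr : delta < rb.
    rewrite /delta gtr_pMr// expR_lt1 oppr_lt0 divr_gt0// addr_gt0//.
  by split => //; rewrite KE ?ltW//= subrr exprn_gt0.
have VU z : ~ level (rho ^+ 2) z -> V z -> U z.
  move=> nl Vz; have dz := z_gt _ Vz; case: Vz => _ Kz; split => //.
  rewrite lt_neqAle Kz andbT; apply/eqP => Ke; apply: nl.
  split; first exact: lt_trans dz.
  by rewrite -Ke KE ?ltW// addrC subrK.
split.
  by move=> [_ /eqP]; rewrite -subr_eq0 opprD addNKr oppr_eq0 expf_eq0 gt_eqF.
have sub : connected_component (~` level (rho ^+ 2)) (rb, 0) `<=` U.
  move=> w [C [Ce CO Cc] Cw].
  have CV : C `&` U = C `&` V.
    apply/seteqP; split=> z [Cz].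
      by move=> [dz Kz]; split => //; split; exact: ltW.
    by move=> Vz; split => //; apply: VU => //; exact: CO.
  have CU : C `&` U = C.
    by apply: Cc; [exists (rb, 0)|exists U|exists V].
  by move: Cw; rewrite -CU => -[].
exists (Num.max (rb * expR (rho / k)) rho); split; first exact: num_real.
move=> B /ltW; rewrite ge_max => /andP[B1 B2] z /sub [dz Kz] /=.
have [] := ln_le z; first by split; exact: ltW.
move=> lnz pz_le; rewrite prod_normE /= ge_max (le_trans pz_le B2) andbT.
have z0 : 0 < z.1 by apply: lt_trans dz.
rewrite gtr0_norm// (le_trans _ B1)// -ler_pdivrMl// mulrC.
rewrite -[leLHS]lnK ?posrE ?divr_gt0// ler_expR.
exact: le_trans (ler_norm _) lnz.
Qed.

Lemma wire_global_center : global_center field half_plane (rb, 0).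
Proof.
split; first exact: (wire_equilibriumP (rb, 0)).2 erefl.
move=> O [z z0 ->] Oe.
(* The excess of energy at [z]; it vanishes only at the equilibrium, whose orbit is excluded by
   [Oe]. *)
pose c := well k M (ln (z.1 / rb)) + z.2 ^+ 2.
have cz : level c z by split=> //; rewrite energy_half_planeE// -addrA.
have c_gt0 : 0 < c.
  have c_ge0 : 0 <= c.
    rewrite addr_ge0 ?sqr_ge0// (le_trans _ (well_ge _ _ (ltW M0)))//.
    by rewrite mulr_ge0 ?sqr_ge0.
  rewrite lt_neqAle c_ge0 andbT; apply/eqP => c0; apply: Oe.
  by rewrite (level0_eq _ : z = (rb, 0)) ?orbit_equilibrium// c0.
have [rho rho0 cE] : exists2 rho, 0 < rho & c = rho ^+ 2.
  exists (Num.sqrt c); first by rewrite sqrtr_gt0.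
  by rewrite sqr_sqrtr// ltW.
have [g [T [T0 sol gT gn gE]]] := level_periodic rho0.
rewrite -cE in gE.
rewrite (orbit_level sol gE cz); split; last first.
  by rewrite cE; exact: level_surrounds.
by exists g, T.
Qed.

End AtEquilibrium.

(** With [s = ln r] the equation asks for a zero of an affine function minus an exponential, found
    by the intermediate value theorem. Uniqueness comes from [wire_equilibriumP]. *)
Lemma wire_equilibrium_radius : exists2 rb : R, 0 < rb &
  k * (pz + k * ln rb) = L ^+ 2 * rb ^- 2.
Proof.
pose f (s : R) := k * (pz + k * s) - L ^+ 2 * expR (- 2 * s).
have df (s : R) : is_derive s 1 f (k * (0 + k * 1) - L ^+ 2 * (- 2 * expR (- 2 * s))).
  exact: is_derive_sub (is_derive_scale _ (is_derive_add (is_derive_cst pz s 1)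
    (is_derive_scale _ (is_derive_id _ _)))) (is_derive_scale _ (is_derive_expscale _ _)).
have cf : continuous f by move=> s; exact: is_derive_continuous (df s).
have k_gt0 : 0 < k := k0.
have k_neq0 := lt0r_neq0 k_gt0.
(* [s1] is the zero of the affine part. Beyond it the exponential term is at most [A], and a step of
   [A / k ^ 2] raises the affine part, of slope [k ^ 2], to [A]. *)
pose s1 := - pz / k; pose A := L ^+ 2 * expR (- 2 * s1).
have A0 : 0 <= A by rewrite mulr_ge0 ?sqr_ge0// expR_ge0.
pose s2 := s1 + A / k ^+ 2.
have s12 : s1 <= s2 by rewrite lerDl divr_ge0// sqr_ge0.
have ks1 : k * (pz + k * s1) = 0.
  by rewrite /s1; move: k k_neq0 => kk kk0; field.
have ks2 : k * (pz + k * s2) = A.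
  rewrite /s2 (mulrDr k s1) addrA (mulrDr k) ks1 add0r mulrA -expr2 mulrCA.
  by rewrite mulfV ?mulr1// expf_neq0.
have f1 : f s1 <= 0 by rewrite /f ks1 sub0r oppr_le0.
have f2 : 0 <= f s2.
  rewrite /f ks2 subr_ge0 ler_wpM2l ?sqr_ge0// ler_expR; lra.
have [|s _ fs] := @IVT R f s1 s2 0 s12 (continuous_subspaceT cf).
  by rewrite ge_min f1 le_max f2 orbT.
exists (expR s); first exact: expR_gt0.
rewrite expRK; move/eqP: fs; rewrite subr_eq0 => /eqP ->.
by rewrite mulNr expRN -expRM_natl.
Qed.

End WireDynamics.

Unset Implicit Arguments.

Theorem mainTheorem3 (R : realType) (mu0 I0 : R) (hmu0 : 0 < mu0) (hI0 : 0 < I0)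
    (L pz : R) (hL : 0 < L) :
  exists rbar : R,
    [/\ 0 < rbar,
        pz + mu0 / (2 * pi) * I0 * ln rbar
          = 2 * pi / mu0 * (L ^+ 2 / I0) * rbar ^- 2,
        forall z : R * R,
          equilibrium (wire_field mu0 I0 L pz) half_plane z <-> z = (rbar, 0)
      & global_center (wire_field mu0 I0 L pz) half_plane (rbar, 0)].
Proof.
have [rb rb0 rbE] := wire_equilibrium_radius L pz hmu0 hI0.
exists rb; split=> //.
- have m0 := lt0r_neq0 hmu0; have i0 := lt0r_neq0 hI0; have b0 := lt0r_neq0 rb0.
  have p0 := lt0r_neq0 (pi_gt0 R).
  have k0 := lt0r_neq0 (coupling_gt0 hmu0 hI0).
  (* The stated equation is [rbE] divided by the coupling [mu0 / (2 * pi) * I0]. *)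
  apply: (mulfI k0); rewrite rbE.
  move: (pi) p0 => p p0; field.
  by rewrite p0 m0 i0 b0.
- exact: wire_equilibriumP.
- exact: wire_global_center.
Qed.
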